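(* Let $m\geq 2$ be an even integer, let $K$ be a totally real number field with ring of integers $\mathcal{O}_K$, let $(\Lambda,Q)$ be a totally positive definite $m$-ic $\mathcal{O}_K$-lattice, let $\alpha\in\mathcal{O}_K^+$, and let $d$ be a positive integer. Then there exist at most finitely many totally real number fields $L\supseteq K$ of degree $[L:\mathbb{Q}]=d$ such that the scalar extension $(\Lambda\otimes_{\mathcal{O}_K}\mathcal{O}_L, Q_L)$ represents all elements of $\alpha\mathcal{O}_L^+=\{\alpha\beta:\beta\in\mathcal{O}_L^+\}$.
   Context: All number fields are subfields of a fixed algebraic closure of $\mathbb{Q}$ containing $K$. A number field is totally real if all its complex embeddings have image in $\mathbb{R}$. An element $\alpha$ of a totally real field $K$ is totally positive if $\sigma(\alpha)>0$ for every embedding $\sigma:K\to\mathbb{R}$; $S^+$ denotes the set of totally positive elements of $S\subseteq K$. $\mathcal{O}_L$ is the ring of integers of $L$. $m$-ic forms: Let $F$ be a field of characteristic $0$ and $V$ a finite-dimensional $F$-vector space. An $m$-ic form on $V$ is a map $Q:V\to F$ with $Q(av)=a^mQ(v)$ for all $a\in F$, $v\in V$ and such that the map $M_Q:V^m\to F$, $M_Q(v_1,\dots,v_m)=\frac{1}{m!}\sum_{I\subseteq\{1,\dots,m\}}(-1)^{m-|I|}Q\left(\sum_{i\in I}v_i\right)$ (an empty sum being $0$), is $F$-multilinear. Then $(V,Q)$ is an $m$-ic space. In coordinates with respect to a basis of $V$, $Q$ is given by a homogeneous polynomial of degree $m$. Lattices: An $m$-ic $\mathcal{O}_K$-lattice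 $(\Lambda,Q)$ is a finitely generated $\mathcal{O}_K$-submodule $\Lambda\subseteq V$ of a finite-dimensional $K$-vector space $V$ (which may be taken to be the $K$-span of $\Lambda$), together with (the restriction of) an $m$-ic form $Q:V\to K$; it is always assumed integral, i.e. $Q(\Lambda)\subseteq\mathcal{O}_K$. It represents $\alpha$ if $Q(v)=\alpha$ for some $v\in\Lambda$. Totally positive definite: for every embedding $\sigma:K\to\mathbb{R}$, the real form $\sigma(Q)$ on $V\otimes_{K,\sigma}\mathbb{R}$ obtained by applying $\sigma$ to the coefficients of $Q$ takes strictly positive values on all nonzero vectors. Scalar extension: $\Lambda\otimes_{\mathcal{O}_K}\mathcal{O}_L$ equipped with $Q_L$, the form obtained by extending $M_Q$ multilinearly; in particular $Q_L(v\otimes a)=a^mQ(v)$. *)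

(* Defs.v *)
From HB Require Import structures.
From mathcomp Require Import all_boot all_order all_algebra all_field.
From mathcomp Require Import classical_sets cardinality reals.
From mathcomp Require Import complex.

Set Implicit Arguments.
Unset Strict Implicit.
Unset Printing Implicit Defensive.

Import Order.TTheory GRing.Theory Num.Theory.
Local Open Scope classical_set_scope.
Local Open Scope ring_scope.

(* A number field is a [fieldExtType rat]; as a subfield of the fixed algebraic
   closure [algC] of the rationals it is the range of a morphism into [algC].
   The real numbers are an arbitrary [R : realType], the complex numbers R[i]. *)

Definition integers (K : fieldExtType rat) : set K :=
  [set x : K | integralOver (fun z : int => z%:~R : K) x].

(* In R[i], [\is Num.real] says that the imaginary part vanishes. *)
Definition totally_real (R : realType) (K : fieldExtType rat) : Prop :=
  forall (s : {rmorphism K -> R[i]}) (x : K), s x \is Num.real.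

Definition totally_positive (R : realType) (K : fieldExtType rat) (x : K) :
    Prop :=
  forall s : {rmorphism K -> R}, 0 < s x.

Section MicForms.
Variables (F : fieldType) (V : vectType F) (m : nat).

Definition polarization (Q : V -> F) (v : 'I_m -> V) : F :=
  (m`!%:R)^-1 *
  \sum_(I : {set 'I_m}) (-1) ^+ (m - #|I|) * Q (\sum_(i in I) v i).

Definition multilinear (M : ('I_m -> V) -> F) : Prop :=
  forall (v : 'I_m -> V) (i : 'I_m) (a : F) (x y : V),
    M [eta v with i |-> a *: x + y] =
    a * M [eta v with i |-> x] + M [eta v with i |-> y].

Definition mic_form (Q : V -> F) : Prop :=
  (forall (a : F) (v : V), Q (a *: v) = a ^+ m * Q v) /\
  multilinear (polarization Q).

End MicForms.

(* All finite linear combinations of elements of [X] with coefficients in [O];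
   this is the O-submodule generated by [X] when [O] is a subring of [F]. *)
Definition span_over (F : fieldType) (V : lmodType F) (O : set F) (X : set V) :
    set V :=
  [set x : V | exists (n : nat) (c : 'I_n -> F) (g : 'I_n -> V),
     [/\ forall i, O (c i), forall i, X (g i)
       & x = \sum_(i < n) c i *: g i]].

Definition fg_submodule (K : fieldExtType rat) (V : vectType K)
    (Lambda : set V) : Prop :=
  exists gens : seq V, Lambda = span_over (@integers K) [set` gens].

Definition mic_lattice (K : fieldExtType rat) (V : vectType K) (m : nat)
    (Lambda : set V) (Q : V -> K) : Prop :=
  [/\ mic_form m Q, fg_submodule Lambda
    & forall v : V, Lambda v -> integers (Q v)].

(* Base change along a field morphism s : K -> F.  The tensor product of V with
   F over K is realised as 'rV[F]_(\dim {:V}), in the coordinates of the basis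
   e = vbasis {:V}: the standard basis consists of the vectors e_i (x) 1, and
   [base_change_vec v] is v (x) 1. *)
Section BaseChange.
Variables (K F : fieldType) (s : {rmorphism K -> F}) (V : vectType K).

Definition base_change_vec (v : V) : 'rV[F]_(\dim {:V}) :=
  \row_i s (coord (vbasis {:V}) i v).

(* The F-multilinear extension of the polarization of Q. *)
Definition base_change_polarization (m : nat) (Q : V -> K)
    (x : 'I_m -> 'rV[F]_(\dim {:V})) : F :=
  \sum_(f : {ffun 'I_m -> 'I_(\dim {:V})})
    (\prod_(j < m) x j 0 (f j)) *
    s (polarization Q (fun j : 'I_m => tnth (vbasis {:V}) (f j))).

Definition base_change_form (m : nat) (Q : V -> K)
    (x : 'rV[F]_(\dim {:V})) : F :=
  base_change_polarization Q (fun _ : 'I_m => x).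

End BaseChange.

Definition totally_positive_definite (R : realType) (K : fieldExtType rat)
    (V : vectType K) (m : nat) (Q : V -> K) : Prop :=
  forall (s : {rmorphism K -> R}) (x : 'rV[R]_(\dim {:V})),
    x != 0 -> 0 < base_change_form s m Q x.

(* A finitely generated submodule of V is torsion-free, hence flat over the
   Dedekind domain O_K, so Lambda (x) O_L embeds in V (x) L, with image the
   O_L-module generated by the vectors v (x) 1 with v in Lambda. *)
Definition scalar_extension (K L : fieldExtType rat) (s : {rmorphism K -> L})
    (V : vectType K) (Lambda : set V) : set 'rV[L]_(\dim {:V}) :=
  span_over (@integers L) [set base_change_vec s v | v in Lambda].

Definition represents (T F : Type) (Lambda : set T) (Q : T -> F) (a : F) :
    Prop :=
  exists2 v : T, Lambda v & Q v = a.

(* Main.v *)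
Require Import Defs.
From HB Require Import structures.
From mathcomp Require Import all_boot all_order all_algebra all_field.
From mathcomp Require Import boolp classical_sets functions cardinality reals.
From mathcomp Require Import topology function_spaces normedtype derive.
From mathcomp Require Import complex zify ring lra.

(** Call the largest absolute value of the real conjugates of x its house.
    The fields L in question turn out to be generated over K by algebraic
    integers whose house is at most a constant X depending only on K, Lambda,
    Q and alpha; there are only finitely many such integers of degree at most
    d ([northcott]), so there are only finitely many such L.

    The constant X comes from a descent ([generated_by_small_integers]).  Let F
    be a subring of L that contains K and every integer of L of house at most
    X; the claim is that F = L.  Take an integer x of house at most n+1, with
    n >= X.  Then beta = x + (n+2) is a totally positive integer of house
    O(n), so alpha * beta = Q_L(v) for some v in the extended lattice.  As Q is
    positive definite at each of the finitely many real places of K,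
    compactness of the unit sphere gives |v_i|^m = O(n) for every coordinate
    v_i of v and at every real place of L, with a constant independent of L
    ([representation_coordinate_bound]).  As m >= 2, this forces the house of
    v_i, once multiplied by a fixed denominator, to be at most n as soon as n
    is large.  By induction on n all the coordinates lie in F; hence so do
    alpha * beta = Q_L(v), then beta, then x.

    To conclude, suppose that two such subfields S and S' of the algebraic
    numbers contain the same elements of the finite set supplied by
    [northcott].  Applying the descent to the preimage of S' in the field L
    that embeds onto S shows that S is contained in S', and S = S' by symmetry.
    A field is thus determined by its trace on a finite set.

    Finally, [northcott] rests on the fact that every complex root of the
    minimal polynomial of x is a conjugate of x under an embedding of L
    ([embedding_with_value]), so that a bound on the house bounds the
    coefficients of that polynomial. *)

Set Implicit Arguments.
Unset Strict Implicit.
Unset Printing Implicit Defensive.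

Import Order.TTheory GRing.Theory Num.Theory numFieldNormedType.Exports.
Local Open Scope classical_set_scope.
Local Open Scope ring_scope.

(** * Extending embeddings of number fields *)

(** A partial embedding is kept as an additive map on the whole of L whose
    multiplicativity is only required on E: an extension to a larger subfield
    then has the same type, and no coercion between subfields is needed. *)
Definition embedding_on (F0 : fieldType) (L : fieldExtType F0) (C : fieldType)
  (E : {vspace L}) (f : {additive L -> C}) : Prop :=
  f 1 = 1 /\ {in E &, {morph f : u v / u * v}}.

(** As E(x) = E[X]/(minPoly E x), evaluation at y of polynomials over E, after
    applying f to their coefficients, factors through E(x). *)
Lemma extend_embedding (F0 C : fieldType) (L : fieldExtType F0)
    (E : {subfield L}) (f : {additive L -> C}) (x : L) (y : C) :
  embedding_on E f -> root (map_poly f (minPoly E x)) y ->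
  exists g : {additive L -> C},
    [/\ embedding_on <<E; x>> g, {in E, g =1 f} & g x = y].
Proof.
case=> f1 fM y_root.
pose fE (z : subvs_of E) := f (val z).
have fE_zmod : zmod_morphism fE by move=> u v; rewrite /fE !raddfB.
have fE_mon : monoid_morphism fE.
  by split=> [|u v]; rewrite /fE ?rmorph1 ?rmorphM //= fM ?subvsP.
pose fEa := GRing.isZmodMorphism.Build _ _ fE fE_zmod.
pose fEm := GRing.isMonoidMorphism.Build _ _ fE fE_mon.
pose phi : {rmorphism subvs_of E -> C} := HB.pack fE fEa fEm.
have lift_val p : map_poly f (map_poly vsval p) = map_poly phi p.
  by apply/polyP=> i; rewrite !coef_map.
(* The representative of z as a polynomial in x has degree less than that of the
   minimal polynomial of x, and is additive in z. *)
pose h z := (map_poly f (Fadjoin_poly E x z)).[y].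
have h_zmod : zmod_morphism h.
  by move=> u v; rewrite /h !raddfB hornerD hornerN.
have h_poly p : p \is a polyOver E -> h p.[x] = (map_poly f p).[y].
  move=> Ep; rewrite /h (Fadjoin_poly_mod x Ep).
  have [p1 Dp1] := polyOver_subvs Ep.
  have [q Dq] := polyOver_subvs (minPolyOver E x).
  move: y_root; rewrite Dp1 Dq -map_modp !lift_val => /rootP qy0.
  by rewrite [in RHS](divp_eq p1 q) rmorphD rmorphM /= !hornerE qy0 mulr0 add0r.
have h_E : {in E, h =1 f}.
  by move=> u Eu; rewrite /h Fadjoin_polyC // map_polyC hornerC.
pose ha := GRing.isZmodMorphism.Build _ _ h h_zmod.
pose g : {additive L -> C} := HB.pack h ha.
exists g; split=> //=.
- split=> [|_ _ /Fadjoin_polyP[p Ep ->] /Fadjoin_polyP[q Eq ->]] /=.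
    by rewrite h_E ?f1 ?mem1v.
  rewrite -hornerM !h_poly ?rpredM // -hornerM; congr _.[_].
  have [p1 ->] := polyOver_subvs Ep; have [q1 ->] := polyOver_subvs Eq.
  by rewrite -rmorphM !lift_val rmorphM.
- have fX : map_poly f 'X = 'X.
    by apply/polyP=> i; rewrite coef_map !coefX; case: eqP; rewrite ?f1 ?raddf0.
  by rewrite -[x in h x]hornerX h_poly ?polyOverX // fX hornerX.
Qed.

Lemma adjoin_separable_generator (L : fieldExtType rat) (E : {subfield L}) :
  <<E; separable_generator E {: L}%AS>>%VS = {: L}%VS.
Proof.
rewrite -eq_adjoin_separable_generator ?subvf //.
apply/separableP=> u _; apply: pcharf0_separable => q.
by rewrite pchar_lalg pchar_num.
Qed.

(** Q(x) is embedded first, by x |-> r; this extends to L = Q(x)(th), with th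
    a primitive element, since C is algebraically closed. *)
Lemma embedding_with_value (C : numClosedFieldType) (L : fieldExtType rat)
    (x : L) (p : {poly rat}) (r : C) :
  map_poly (in_alg L) p = minPoly 1 x -> root (map_poly ratr p) r ->
  exists f : {rmorphism L -> C}, f x = r.
Proof.
move=> Dp pr0.
(* The coordinate along 1 extends the identity of Q 1 additively to L. *)
pose f0 (z : L) : C := ratr (coord [tuple 1 : L] 0 z).
have f0_zmod : zmod_morphism f0.
  by move=> u v; rewrite /f0 !raddfB.
have f0_alg k : f0 k%:A = ratr k.
  rewrite /f0 linearZ /= (coord_free 0 0 (X:=[tuple 1 : L])) ?mulr1 //.
  by rewrite free_cons nil_free span_nil memv0 oner_eq0.
pose f0a := GRing.isZmodMorphism.Build _ _ f0 f0_zmod.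
pose f0A : {additive L -> C} := HB.pack f0 f0a.
have f0P : embedding_on 1%AS f0A.
  split=> [|_ _ /vlineP[a ->] /vlineP[b ->]] /=.
    by rewrite -[1]scale1r f0_alg rmorph1.
  by rewrite -scalerAl mul1r scalerA !f0_alg rmorphM.
have [|f1 [f1P f1_1 f1x]] := @extend_embedding _ _ _ 1%AS f0A x r f0P.
  rewrite -Dp; congr root: pr0; apply/polyP=> i.
  by rewrite !coef_map /= f0_alg.
pose th := separable_generator <<1; x>>%AS {: L}%AS.
have Dth : <<<<1; x>>; th>>%VS = {: L}%VS by apply: adjoin_separable_generator.
pose P := map_poly f1 (minPoly <<1; x>>%AS th).
have [y Py] : exists y, root P y.
  apply/closed_rootP; rewrite size_map_poly_id0 ?size_minPoly //.
    by rewrite (monicP (monic_minPoly _ _)) (proj1 f1P) oner_eq0.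
have [f2 [f2P f2E _]] := extend_embedding f1P Py.
have f2_mon : monoid_morphism f2.
  by split=> [|u v]; [case: f2P | apply: (proj2 f2P); rewrite Dth memvf].
pose f2m := GRing.isMonoidMorphism.Build _ _ f2 f2_mon.
pose f2a := GRing.isZmodMorphism.Build _ _ f2 (raddfB f2).
pose g : {rmorphism L -> C} := HB.pack (f2 : L -> C) f2a f2m.
by exists g; rewrite /= f2E ?memv_adjoin.
Qed.

(** * Northcott's theorem for totally real fields *)

Definition house_le (R : realType) (L : fieldExtType rat) (x : L) (n : nat) :
    Prop :=
  forall s : {rmorphism L -> R}, `|s x| <= n%:R.

Lemma minPoly_rat (L : fieldExtType rat) (x : L) :
  exists2 p : {poly rat}, p \is monic & map_poly (in_alg L) p = minPoly 1 x.
Proof.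
have [p Dp] : exists p : {poly rat}, minPoly 1 x = map_poly (in_alg L) p.
  by apply/polyOver1P; apply: minPolyOver.
by exists p => //; rewrite -(map_monic (in_alg L)) -Dp monic_minPoly.
Qed.

Lemma real_embedding (R : realType) (L : fieldExtType rat)
    (s : {rmorphism L -> R[i]}) :
  totally_real R L -> exists t : {rmorphism L -> R}, forall x, s x = (t x)%:C%C.
Proof.
move=> Lreal.
pose t x := complex.Re (s x).
have st x : s x = (t x)%:C%C by rewrite RRe_real.
have t_zmod : zmod_morphism t.
  by move=> x y; apply: complexI; rewrite rmorphB /= -!st rmorphB.
have t_mon : monoid_morphism t.
  split=> [|x y]; apply: complexI; first by rewrite -st !rmorph1.
  by rewrite rmorphM /= -!st rmorphM.
pose ta := GRing.isZmodMorphism.Build _ _ t t_zmod.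
pose tm := GRing.isMonoidMorphism.Build _ _ t t_mon.
pose g : {rmorphism L -> R} := HB.pack t ta tm.
by exists g.
Qed.

(** Multiplying by 'X - r%:P replaces the k-th coefficient a_k by
    a_(k-1) - r a_k, hence multiplies a bound on all of them by 1 + b. *)
Lemma coef_prod_XsubC_le (F : numDomainType) (rs : seq F) (b : F) (k : nat) :
  0 <= b -> {in rs, forall r, `|r| <= b} ->
  `|(\prod_(r <- rs) ('X - r%:P))`_k| <= (1 + b) ^+ size rs.
Proof.
move=> b_ge0; elim: rs k => [|r rs IH] k rs_le.
  by rewrite big_nil coef1 expr0; case: eqP; rewrite ?normr1 ?normr0 ?ler01.
have {}IH k' : `|(\prod_(r <- rs) ('X - r%:P))`_k'| <= (1 + b) ^+ size rs.
  by apply: IH => q q_rs; rewrite rs_le // inE q_rs orbT.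
have b1_ge0 : 0 <= (1 + b) ^+ size rs by rewrite exprn_ge0 ?addr_ge0.
rewrite big_cons mulrBl coefB coefXM coefCM exprS mulrDl mul1r.
apply: le_trans (ler_normB _ _) (lerD _ _).
  by case: eqP => // _; rewrite normr0.
by rewrite normrM ler_pM ?rs_le ?mem_head.
Qed.

(** Comparing with the minimal polynomial of j x over the rationals, which has
    integer coefficients since j x is an algebraic integer. *)
Lemma integral_minPoly (L : fieldExtType rat) (j : {rmorphism L -> algC})
    (x : L) (p : {poly rat}) :
  integers x -> p \is monic -> map_poly (in_alg L) p = minPoly 1 x ->
  p \is a polyOver Num.int.
Proof.
case=> q q_mon q_x p_mon Dp.
have jx_int : j x \in Aint.
  apply: (@root_monic_Aint (map_poly intr q)).
  - move: (rmorph_root j q_x); rewrite -map_poly_comp; congr root.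
    by apply: eq_map_poly => c /=; rewrite rmorph_int.
  - exact: monic_map.
  - by apply/polyOverP=> i; rewrite coef_map /= Num.Theory.intr_int.
have ratrj (c : rat) : j (in_alg L c) = ratr c.
  by rewrite -(fmorph_eq_rat (j \o in_alg L)).
have [p' [Dp' p'_mon] p'_min] := minCpolyP (j x).
(* Both polynomials are monic, and each is minimal among those vanishing at x,
   respectively j x; j identifies the two conditions. *)
have -> : p = p'.
  apply/eqP; rewrite -eqp_monic // /eqp; apply/andP; split.
    rewrite -(dvdp_map (in_alg L)) Dp; apply: minPoly_dvdp.
      by apply/polyOver1P; exists p'.
    rewrite -(fmorph_root j) -map_poly_comp (eq_map_poly ratrj) -Dp'.
    exact: root_minCpoly.
  rewrite -p'_min -(eq_map_poly ratrj) map_poly_comp Dp fmorph_root.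
  exact: root_minPoly.
apply/polyOverP=> i.
by move: jx_int => /polyOverP/(_ i); rewrite Dp' coef_map /= Cint_rat.
Qed.

(** Such polynomials are encoded by the finite functions from 'I_N to
    'I_(2B+1), the value k standing for the coefficient k - B. *)
Lemma bounded_int_poly_roots (N B : nat) :
  exists T : seq algC, forall (p : {poly rat}) (z : algC),
    (size p <= N)%N -> p != 0 -> p \is a polyOver Num.int ->
    (forall i, `|p`_i| <= B%:R) -> root (map_poly ratr p) z -> z \in T.
Proof.
pose P (f : {ffun 'I_N -> 'I_(B.*2.+1)}) : {poly algC} :=
  \poly_(i < N) (oapp (fun k : 'I_N => (f k : nat)%:R - B%:R) 0 (insub i)).
pose rts (q : {poly algC}) : seq algC := sval (closed_field_poly_normal q).
exists (flatten [seq rts (P f) | f <- enum {ffun 'I_N -> 'I_(B.*2.+1)}]).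
move=> p z szp p0 /polyOverP pint p_le pz.
have coef_nat i : exists k : 'I_(B.*2.+1), p`_i == (k : nat)%:R - B%:R.
  have [c Dc] := intrP (pint i).
  have cB : `|c| <= B%:Z by rewrite -(ler_int rat) intr_norm -Dc; apply: p_le.
  have k_ge0 : 0 <= c + B%:Z by move: cB; rewrite ler_norml => /andP[]; lia.
  have kB : (`|(c + B%:Z)%R| < B.*2.+1)%N.
    by move: cB; rewrite ler_norml => /andP[]; lia.
  exists (Ordinal kB) => /=.
  by rewrite Dc natr_absz ger0_norm // intrD addrK.
pose f : {ffun 'I_N -> 'I_(B.*2.+1)} := [ffun i : 'I_N => xchoose (coef_nat i)].
have Dp : map_poly ratr p = P f.
  apply/polyP=> i; rewrite coef_map coef_poly /=.
  case: ltnP => [iN | Ni]; last first.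
    by rewrite nth_default ?rmorph0 // (leq_trans szp).
  rewrite insubT /= ffunE {1}(eqP (xchooseP (coef_nat i))) rmorphB /=.
  by rewrite !ratr_nat.
apply/flatten_mapP; exists f; first by rewrite mem_enum.
rewrite /rts; case: closed_field_poly_normal => rs /= Drs.
move: pz; rewrite Dp Drs rootZ ?root_prod_XsubC // -Dp lead_coef_map.
by rewrite fmorph_eq0 lead_coef_eq0.
Qed.

(** The roots of the minimal polynomial of x in the complex numbers are
    conjugates of x, hence real and bounded by n; so its coefficients are
    integers of absolute value at most (1 + n)^d. *)
Theorem northcott (R : realType) (d n : nat) :
  exists T : seq algC,
    forall (L : fieldExtType rat) (j : {rmorphism L -> algC}) (x : L),
      totally_real R L -> \dim {: L} = d -> integers x -> house_le R x n ->
      j x \in T.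
Proof.
have [T TP] := bounded_int_poly_roots d.+1 (n.+1 ^ d).
exists T => L j x Lreal dimL x_int x_le.
have [p p_mon Dp] := minPoly_rat x.
have szp : (size p <= d.+1)%N.
  rewrite -(size_map_poly (in_alg L)) Dp size_minPoly ltnS -dimL.
  have := dim_Fadjoin 1%AS x; rewrite dimv1 muln1 => <-.
  exact/dimvS/subvf.
have ratrj (c : rat) : j (in_alg L c) = ratr c.
  by rewrite -(fmorph_eq_rat (j \o in_alg L)).
apply: (TP p) => //; first by rewrite monic_neq0.
- exact: (integral_minPoly j x_int p_mon Dp).
- move=> i.
  have [rs Drs] := closed_field_poly_normal (map_poly (ratr : rat -> R[i]) p).
  have rs_le : {in rs, forall r, `|r| <= n%:R}.
    move=> r r_rs.
    have [|f <-] := @embedding_with_value _ _ x p r Dp.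
      rewrite Drs rootZ ?root_prod_XsubC // lead_coef_map fmorph_eq0.
      by rewrite lead_coef_eq0 monic_neq0.
    have [t ->] := real_embedding f Lreal.
    rewrite normc_def /= expr0n addr0 sqrtr_sqr.
    by rewrite -(rmorph_nat (real_complex R)) lecR.
  have := coef_prod_XsubC_le i (ler0n _ n) rs_le.
  have sz_rs : (size rs <= d)%N.
    rewrite -ltnS -(size_prod_XsubC rs id) -(size_scale _ (oner_neq0 R[i])).
    move: szp; rewrite -(size_map_poly (ratr : rat -> R[i])) Drs.
    by rewrite lead_coef_map (monicP p_mon) rmorph1.
  move: Drs; rewrite lead_coef_map (monicP p_mon) rmorph1 scale1r => <-.
  rewrite coef_map /= -ratr_norm => p_i; rewrite -(ler_rat R[i]).
  apply: le_trans p_i _; rewrite ratr_nat natrX -nat1r.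
  by apply: ler_weXn2l => //; rewrite lerDl.
- rewrite -(eq_map_poly ratrj) map_poly_comp Dp fmorph_root.
  exact: root_minPoly.
Qed.

(** * Coercivity of positive definite forms *)

Lemma normr_coord_le (R : realType) n (x : 'rV[R]_n) (i : 'I_n) :
  `|x 0 i| <= `|x|.
Proof.
rewrite [leRHS]/Num.norm /= mx_normrE.
by apply: (le_bigmax_cond _ (fun k => `|x k.1 k.2|) (j := (0, i))).
Qed.

(** By homogeneity it suffices to bound f from below on the unit sphere, where
    it attains a positive minimum by compactness. *)
Lemma homogeneous_coercive (R : realType) (n m : nat) (f : 'rV[R]_n -> R) :
  continuous f -> (forall (a : R) x, f (a *: x) = a ^+ m * f x) ->
  (forall x : 'rV[R]_n, x != 0 -> 0 < f x) ->
  exists2 C : R, 0 < C & forall (x : 'rV[R]_n) (i : 'I_n),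
    x != 0 -> `|x 0 i| ^+ m <= C * f x.
Proof.
move=> f_cont f_hom f_pos.
pose S := [set x : 'rV[R]_n | `|x| = 1].
have S_compact : compact S.
  apply: bounded_closed_compact.
    by exists 1; split=> // M M1 x /= ->; apply: ltW.
  rewrite (_ : S = Num.norm @^-1` [set x | x = 1]) //.
  apply: preimage_closed => [x _|]; first exact: norm_continuous.
  exact: closed_eq.
(* The sphere is empty when n = 0; every x is then zero. *)
have [[x0 Sx0]|S0] := pselect (S !=set0); last first.
  exists 1 => // x i x_neq0; case: S0; exists (`|x|^-1 *: x) => /=.
  by rewrite /S /= normrZ normfV normr_id mulVf ?normr_eq0.
have [||c cS c_min] := @compact_EVT_min _ R f S _ S_compact.
- by exists x0.
- exact: continuous_subspaceT.
have fc : 0 < f c.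
  by apply: f_pos; rewrite -normr_eq0 (set_mem cS) oner_eq0.
exists (f c)^-1 => [|x i x_neq0]; first by rewrite invr_gt0.
rewrite mulrC ler_pdivlMr //.
have nx : 0 < `|x| by rewrite normr_gt0.
have {2}-> : x = `|x| *: (`|x|^-1 *: x).
  by rewrite scalerA divff ?scale1r ?gt_eqF.
rewrite f_hom; apply: ler_pM (exprn_ge0 _ _) (ltW fc) _ _ => //.
  by rewrite lerXn2r ?nnegrE ?normr_ge0 ?normr_coord_le.
by apply: c_min; rewrite inE /S /= normrZ normfV normr_id mulVf ?gt_eqF.
Qed.

Section BaseChangeForm.
Variables (K F : fieldType) (s : {rmorphism K -> F}) (V : vectType K).
Variables (m : nat) (Q : V -> K).

Lemma base_change_formZ (a : F) (x : 'rV[F]_(\dim {:V})) :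
  base_change_form s m Q (a *: x) = a ^+ m * base_change_form s m Q x.
Proof.
rewrite /base_change_form /base_change_polarization mulr_sumr.
apply: eq_bigr => f _; rewrite mulrA; congr (_ * _).
rewrite -[in X in a ^+ X](card_ord m) -prodr_const -big_split /=.
by apply: eq_bigr => j _; rewrite mxE.
Qed.

End BaseChangeForm.

Lemma base_change_form_continuous (K : fieldType) (R : realType)
  (s : {rmorphism K -> R}) (V : vectType K) (m : nat) (Q : V -> K) :
  continuous (base_change_form s m Q : 'rV[R]_(\dim {:V}) -> R).
Proof.
rewrite /base_change_form /base_change_polarization.
apply: continuous_big => [|f _]; first exact: add_continuous.
have prod_cont :
    continuous (fun x : 'rV[R]_(\dim {:V}) => \prod_(j < m) x 0 (f j)).
  apply: continuous_big => [|j _]; first exact: mul_continuous.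
  exact: coord_continuous.
by move=> x; apply: cvgM (prod_cont x) (cvg_cst _).
Qed.

(** * Rings of integers *)

Section Integers.
Variable L : fieldExtType rat.
Implicit Types x y : L.

Lemma integersD x y : integers x -> integers y -> integers (x + y).
Proof. exact: integral_add. Qed.

Lemma integersM x y : integers x -> integers y -> integers (x * y).
Proof. exact: integral_mul. Qed.

Lemma integers_nat n : integers (n%:R : L).
Proof. exact: integral_nat. Qed.

Lemma integers_sum (I : finType) (f : I -> L) :
  (forall i, integers (f i)) -> integers (\sum_i f i).
Proof.
move=> f_int; apply: (big_ind (fun x => integers x)) => //.
  exact: (integers_nat 0).
exact: integersD.
Qed.

Lemma integers_rmorph (K : fieldExtType rat) (s : {rmorphism K -> L}) (x : K) :
  integers x -> integers (s x).
Proof.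
move=> [p p_mon px]; exists p => //; move: (rmorph_root s px).
rewrite -map_poly_comp; congr root; apply: eq_map_poly => c /=.
by rewrite rmorph_int.
Qed.

(** If q has degree n and leading coefficient a, then a^(n-1) q is a monic
    integer polynomial in a X. *)
Lemma lead_coef_root_integral (q : {poly int}) x :
  root (map_poly intr q) x -> (1 < size q)%N ->
  integers ((lead_coef q)%:~R * x).
Proof.
move=> qx szq; set a := lead_coef q; pose n := (size q).-1.
have szqE : size q = n.+1 by rewrite /n; lia.
pose tl := \poly_(i < n) (q`_i * a ^+ (n.-1 - i)).
exists ('X^n + tl).
  by rewrite monicE lead_coefDl ?lead_coefXn // size_polyXn ltnS size_poly.
rewrite /root rmorphD /= map_polyXn hornerD hornerXn.
have -> : map_poly intr tl = \poly_(i < n) ((q`_i * a ^+ (n.-1 - i))%:~R : L).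
  by apply/polyP=> i; rewrite coef_map !coef_poly; case: ifP; rewrite ?rmorph0.
apply/eqP; transitivity (a%:~R ^+ n.-1 * (map_poly intr q).[x]); last first.
  by rewrite (rootP qx) mulr0.
have n_gt0 : (0 < n)%N by rewrite /n; lia.
rewrite horner_poly (@horner_coef_wide _ n.+1) -?szqE ?size_poly // szqE.
rewrite big_ord_recr /= mulrDr addrC mulr_sumr; congr (_ + _); last first.
  rewrite coef_map /= -[q`_n]/(q`_(size q).-1) -/(lead_coef q) -/a.
  by rewrite mulrA -exprSr prednK // exprMn.
apply: eq_bigr => i _; rewrite coef_map /= rmorphM rmorphXn /= exprMn.
have /subnK {2}<- : (i <= n.-1)%N by have := ltn_ord i; lia.
by rewrite exprD; ring.
Qed.

Lemma exists_denominator x : exists2 D : nat, (0 < D)%N & integers (D%:R * x).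
Proof.
have [p p_mon Dp] := minPoly_rat x.
have [q [a a_neq0 Dpq]] := rat_poly_scale p.
have Dq : map_poly intr q = a%:~R *: p.
  by rewrite Dpq scalerA divff ?scale1r // intr_eq0.
have lead_q : lead_coef q = a.
  apply: (@intr_inj rat); rewrite -lead_coef_map_inj //; last exact: intr_inj.
  by rewrite Dq lead_coefZ (monicP p_mon) mulr1.
have qx : root (map_poly intr q : {poly L}) x.
  have -> : map_poly intr q = map_poly (in_alg L) (map_poly intr q).
    by rewrite -map_poly_comp; apply: eq_map_poly => c; rewrite /= scaler_int.
  rewrite Dq map_polyZ /= rootZ ?Dp ?root_minPoly //.
  by rewrite scaler_eq0 negb_or intr_eq0 oner_neq0 andbT.
have szq : (1 < size q)%N.
  rewrite -(@size_map_inj_poly _ rat intr) //; last exact: intr_inj.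
  rewrite Dq size_scale ?intr_eq0 // -(size_map_poly (in_alg L)) Dp.
  by rewrite size_minPoly.
exists `|a|%N; first by rewrite absz_gt0.
have := lead_coef_root_integral qx szq; rewrite lead_q.
rewrite pmulrn abszE; case: (ger0P a) => _ //.
by rewrite rmorphN mulNr; apply: integral_opp.
Qed.

Lemma exists_common_denominator (xs : seq L) :
  exists2 D : nat, (0 < D)%N & {in xs, forall x, integers (D%:R * x)}.
Proof.
elim: xs => [|x xs [D D_gt0 D_xs]]; first by exists 1%N.
have [D' D'_gt0 D'_x] := exists_denominator x.
exists (D' * D)%N => [|y]; first by rewrite muln_gt0 D_gt0 D'_gt0.
rewrite inE natrM => /predU1P[-> | /D_xs y_int].
  by rewrite mulrAC; apply: integersM (integers_nat _).
by rewrite -mulrA; apply: integersM (integers_nat _) _.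
Qed.

End Integers.

(** * Bounds uniform over the real embeddings *)

Section Embeddings.
Variables (R : realType) (L : fieldExtType rat).

Lemma poly_roots_listable (p : {poly R}) :
  p != 0 -> exists rs : seq R, forall r, root p r -> r \in rs.
Proof.
move=> p_neq0.
have [rs Drs] := closed_field_poly_normal (map_poly (real_complex R) p).
exists [seq complex.Re z | z <- rs] => r pr.
apply/mapP; exists (r%:C)%C => //.
have : root (map_poly (real_complex R) p) (r%:C)%C by rewrite fmorph_root.
by rewrite Drs rootZ ?root_prod_XsubC // lead_coef_map fmorph_eq0 lead_coef_eq0.
Qed.

Lemma eq_rmorph_generator (th : L) (s s' : {rmorphism L -> R}) :
  <<1; th>>%VS = {: L}%VS -> s th = s' th -> s =1 s'.
Proof.
move=> Dth s_th x.
have /Fadjoin_polyP[_ /polyOver1P[p ->] ->] : x \in <<1; th>>%VS.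
  by rewrite Dth memvf.
rewrite -!horner_map -!map_poly_comp s_th; congr _.[_].
apply: eq_map_poly => c.
by rewrite (fmorph_eq_rat (s \o _)) (fmorph_eq_rat (s' \o _)).
Qed.

(** L has finitely many embeddings into R, as an embedding is determined by the
    image of a primitive element, which is a root of a fixed polynomial.  The
    first hypothesis is needed because P speaks of bundled morphisms, which are
    only compared pointwise. *)
Lemma uniform_embedding_bound (P : {rmorphism L -> R} -> nat -> Prop) :
  (forall (s s' : {rmorphism L -> R}) n, s =1 s' -> P s n -> P s' n) ->
  (forall s n n', (n <= n')%N -> P s n -> P s n') ->
  (forall s, exists n, P s n) -> exists n, forall s, P s n.
Proof.
move=> P_ext P_mono P_ex.
have [th Dth] : exists th : L, <<1; th>>%VS = {: L}%VS.
  exists (separable_generator 1%AS {: L}%AS).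
  exact: adjoin_separable_generator.
have [p p_mon Dp] := minPoly_rat th.
have [|rs rsP] := @poly_roots_listable (map_poly ratr p).
  by rewrite map_poly_eq0 monic_neq0.
suff [n nP] : exists n, forall s : {rmorphism L -> R}, s th \in rs -> P s n.
  exists n => s; apply: nP; apply: rsP.
  have /(rmorph_root s) := root_minPoly 1%AS th; rewrite -Dp -map_poly_comp.
  congr root; apply: eq_map_poly => c; exact: (fmorph_eq_rat (s \o in_alg L)).
elim: rs {rsP} => [|r rs [n nP]]; first by exists 0%N.
have [[s0 s0_th] | no_s] := pselect (exists s : {rmorphism L -> R}, s th = r).
  have [n0 n0P] := P_ex s0.
  exists (maxn n n0) => s; rewrite inE => /predU1P[s_th | /nP].
    apply: P_mono (leq_maxr _ _) _; apply: P_ext n0P.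
    by apply: eq_rmorph_generator Dth _; rewrite s0_th.
  exact: P_mono (leq_maxl _ _).
exists n => s; rewrite inE => /predU1P[s_th | /nP //].
by case: no_s; exists s.
Qed.

Lemma house_bounded (x : L) : exists n, house_le R x n.
Proof.
apply: (@uniform_embedding_bound (fun s n => `|s x| <= n%:R)).
- by move=> s s' n <-.
- by move=> s n n' nn' /le_trans-> //; rewrite ler_nat.
- move=> s; exists (Num.truncn `|s x|).+1.
  exact/ltW/truncnS_gt.
Qed.

End Embeddings.

Lemma posdef_uniformly_coercive (R : realType) (K : fieldExtType rat)
    (V : vectType K) (m : nat) (Q : V -> K) :
  (0 < m)%N -> totally_positive_definite R m Q ->
  exists C : nat, forall (s : {rmorphism K -> R}) (x : 'rV[R]_(\dim {:V})) i,
    `|x 0 i| ^+ m <= C%:R * base_change_form s m Q x.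
Proof.
move=> m_gt0 Qpos.
have form0 (s : {rmorphism K -> R}) :
    base_change_form s m Q (0 : 'rV[R]_(\dim {:V})) = 0.
  by rewrite -(scale0r 0) base_change_formZ expr0n gtn_eqF // mul0r.
have form_ge0 (s : {rmorphism K -> R}) x : 0 <= base_change_form s m Q x.
  by have [-> | /(Qpos s)/ltW //] := eqVneq x 0; rewrite form0.
apply: uniform_embedding_bound => [s s' n ss' | s n n' nn' sP x i | s].
- have -> // : base_change_form s' m Q =
      base_change_form s m Q :> ('rV[R]_(\dim {:V}) -> R).
  apply/funext => x; apply: eq_bigr => f _.
  by rewrite -ss'.
- by apply: le_trans (sP x i) _; rewrite ler_wpM2r ?ler_nat.
- have [C C_gt0 CP] := homogeneous_coercive
    (@base_change_form_continuous K R s V m Q)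
    (@base_change_formZ K R s V m Q) (Qpos s).
  exists (Num.truncn C).+1 => x i.
  have [-> | x_neq0] := eqVneq x 0.
    by rewrite mxE normr0 form0 mulr0 expr0n gtn_eqF.
  apply: le_trans (CP x i x_neq0) _; apply: ler_wpM2r => //.
  exact/ltW/truncnS_gt.
Qed.

(** * Coordinates of representing vectors *)

(** Base change is transitive, which turns values of Q over L into values of
    the real forms for which positivity is known. *)
Lemma base_change_form_rmorph (K L F : fieldType) (s : {rmorphism K -> L})
    (t : {rmorphism L -> F}) (V : vectType K) (m : nat) (Q : V -> K)
    (v : 'rV[L]_(\dim {:V})) :
  t (base_change_form s m Q v) = base_change_form (t \o s) m Q (map_mx t v).
Proof.
rewrite /base_change_form /base_change_polarization rmorph_sum /=.
apply: eq_bigr => f _; rewrite rmorphM rmorph_prod; congr (_ * _).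
by apply: eq_bigr => j _; rewrite mxE.
Qed.

(** The coordinates of finitely many generators of Lambda have a common
    denominator, and an extension of scalars keeps the generators: D depends
    neither on L nor on the vector. *)
Lemma scalar_extension_common_denominator (K : fieldExtType rat)
    (V : vectType K) (Lambda : set V) :
  fg_submodule Lambda ->
  exists2 D : nat, (0 < D)%N &
    forall (L : fieldExtType rat) (s : {rmorphism K -> L})
           (v : 'rV[L]_(\dim {:V})) i,
      scalar_extension s Lambda v -> integers (D%:R * v 0 i).
Proof.
case=> gens ->.
pose e i (g : V) : K := coord (vbasis {:V}) i g.
have [D D_gt0 D_gens] := exists_common_denominator
  [seq e i g | i <- enum 'I_(\dim {:V}), g <- gens].
exists D => // L s v i [n [c [g [c_int g_in ->]]]].
rewrite summxE mulr_sumr; apply: integers_sum => k.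
have [_ [l [a [u [a_int u_in ->]]]] <-] := g_in k.
rewrite !mxE mulrCA; apply: integersM (c_int k) _.
rewrite -[D%:R](rmorph_nat s) -rmorphM; apply: integers_rmorph.
rewrite linear_sum mulr_sumr; apply: integers_sum => h.
rewrite linearZ /= mulrCA; apply: integersM (a_int h) _.
apply: D_gens; apply/allpairsP; exists (i, u h); split=> //=.
  by rewrite mem_enum.
exact: u_in.
Qed.

(** Total positivity only says something once K has a real embedding: some
    complex embedding exists, and total reality makes it real. *)
Lemma totally_positive_neq0 (R : realType) (K : fieldExtType rat) (x : K) :
  totally_real R K -> totally_positive R x -> x != 0.
Proof.
move=> K_real x_pos.
have [p p_mon Dp] := minPoly_rat x.
have [r pr] : exists r : R[i], root (map_poly ratr p) r.
  apply/closed_rootP.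
  by rewrite size_map_poly -(size_map_poly (in_alg K)) Dp size_minPoly.
have [f _] := embedding_with_value Dp pr.
have [t _] := real_embedding f K_real.
by rewrite -(fmorph_eq0 t) gt_eqF ?x_pos.
Qed.

Section Descent.
Variables (R : realType) (m : nat) (K : fieldExtType rat).
Variables (V : vectType K) (Lambda : set V) (Q : V -> K) (alpha : K).
Hypotheses (m_ge2 : (2 <= m)%N) (K_real : totally_real R K).
Hypotheses (Lambda_fg : fg_submodule Lambda).
Hypotheses (Q_posdef : totally_positive_definite R m Q).
Hypotheses (alpha_pos : totally_positive R alpha).

(** Coercivity of Q at the real places of K, transported to L: each real
    embedding t of L restricts to one of K, and D and C do not depend on L. *)
Lemma representation_coordinate_bound :
  exists2 D : nat, (0 < D)%N & exists C : nat,
  forall (L : fieldExtType rat) (s : {rmorphism K -> L})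
         (v : 'rV[L]_(\dim {:V})) (beta : L) i,
    scalar_extension s Lambda v ->
    base_change_form s m Q v = s alpha * beta ->
    integers (D%:R * v 0 i) /\
    forall t : {rmorphism L -> R}, 0 <= t beta ->
      `|t (D%:R * v 0 i)| ^+ m <= C%:R * t beta.
Proof.
have [C0 C0P] := posdef_uniformly_coercive (ltnW m_ge2) Q_posdef.
have [A AP] := house_bounded R alpha.
have [D D_gt0 DP] := scalar_extension_common_denominator Lambda_fg.
exists D => //; exists (D ^ m * C0 * A)%N => L s v beta i v_in Qv.
split=> [|t tb_ge0]; first exact: DP v_in.
rewrite rmorphM normrM rmorph_nat normr_nat exprMn !natrM natrX -!mulrA.
apply: ler_wpM2l; first by rewrite exprn_ge0.
have := C0P (t \o s) (map_mx t v) i.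
rewrite -base_change_form_rmorph Qv mxE rmorphM => /le_trans-> //.
rewrite ler_wpM2l // ler_wpM2r //.
exact: le_trans (ler_norm _) (AP (t \o s)).
Qed.

(** * The descent *)

(** F is an arbitrary subring containing the image of K rather than a subfield:
    it automatically contains the rationals, and this is all that the descent
    uses, since every element of L is an integer divided by a natural number. *)
Lemma generated_by_small_integers :
  exists X : nat,
  forall (L : fieldExtType rat) (s : {rmorphism K -> L}) (F : set L),
    (forall beta : L, integers beta -> totally_positive R beta ->
       represents (scalar_extension s Lambda) (base_change_form s m Q)
                  (s alpha * beta)) ->
    (forall x y, F x -> F y -> F (x + y)) ->
    (forall x y, F x -> F y -> F (x * y)) ->
    (forall k, F (s k)) ->
    (forall x, integers x -> house_le R x X -> F x) ->
    forall x, F x.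
Proof.
have [D D_gt0 [C CP]] := representation_coordinate_bound.
(* The descent step needs C (2 n + 3) <= n ^ 2, which holds for n >= 4 C + 4. *)
exists (4 * C + 4)%N => L s F repr FD FM Fs F_small.
have F_denom n x : (0 < n)%N -> F (n%:R * x) -> F x.
  move=> n_gt0 Fnx.
  have n_neq0 : (n%:R : K) != 0.
    by rewrite -(rmorph_nat (in_alg K)) fmorph_eq0 pnatr_eq0 -lt0n.
  rewrite -[x](mulKf (x:=s n%:R)) ?fmorph_eq0 // -fmorphV rmorph_nat.
  exact: FM.
have F_form (v : 'rV[L]_(\dim {:V})) :
      (forall i, F (v 0 i)) -> F (base_change_form s m Q v).
  move=> Fv; apply: (big_ind F) => // [|f _].
    by rewrite -(rmorph0 s).
  apply/FM => //; apply: (big_ind F) => //.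
  by rewrite -(rmorph1 s).
have descent k x : integers x -> house_le R x (4 * C + 4 + k) -> F x.
  elim: k x => [|k IH] x x_int x_le.
    by apply: F_small; rewrite // addn0 in x_le.
  set n := (4 * C + 4 + k)%N in IH; rewrite addnS -/n in x_le.
  pose beta := x + n.+2%:R.
  have beta_bd (t : {rmorphism L -> R}) : 0 < t beta <= (n.+1 + n.+2)%:R.
    have := x_le t; rewrite rmorphD rmorph_nat ler_norml => /andP[lo hi].
    have n12 : n.+2%:R = n.+1%:R + 1 :> R by rewrite -natr1.
    by rewrite natrD n12; apply/andP; split; lra.
  have beta_int : integers beta by apply: integersD (integers_nat _ _).
  have beta_pos : totally_positive R beta by move=> t; case/andP: (beta_bd t).
  have [v v_in Qv] := repr beta beta_int beta_pos.
  have Fv i : F (v 0 i).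
    apply: F_denom D_gt0 _.
    have [y_int y_le] := CP L s v beta i v_in Qv.
    apply: IH => // t; have /andP[tb_gt0 tb_le] := beta_bd t.
    rewrite -(@ler_pXn2r _ m) ?nnegrE ?(ltnW m_ge2) //.
    apply: le_trans (y_le t (ltW tb_gt0)) _.
    apply: le_trans (ler_wpM2l (ler0n _ _) tb_le) _.
    rewrite -natrM -natrX ler_nat.
    (* A bound linear in n suffices because the exponent m is at least 2. *)
    apply: (@leq_trans (n ^ 2)); last by rewrite leq_exp2l; lia.
    rewrite /n; nia.
  have Fsb : F (s alpha * beta) by rewrite -Qv; apply: F_form.
  have -> : x = s alpha^-1 * (s alpha * beta) + s (- n.+2%:R).
    rewrite fmorphV mulKf ?rmorphN ?rmorph_nat ?addrK // fmorph_eq0.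
    exact: totally_positive_neq0 K_real alpha_pos.
  by apply: FD => //; apply: FM.
move=> x; have [n n_gt0 nx_int] := exists_denominator x.
apply: F_denom n_gt0 _; have [k k_le] := house_bounded R (n%:R * x).
apply: (descent k) => // t; apply: le_trans (k_le t) _.
by rewrite ler_nat leq_addl.
Qed.

End Descent.

(** * Finiteness *)

(** By antisymmetry, a member of A is determined by the subset of ts that it
    contains, and ts has finitely many subsets. *)
Lemma finite_set_of_traces (T : choiceType) (ts : seq T) (A : set (set T)) :
  (forall S S', A S -> A S' ->
     (forall t, t \in ts -> S t -> S' t) -> S `<=` S') ->
  finite_set A.
Proof.
move=> A_sub.
pose trace (S : set T) : {set seq_sub ts} := [set t | `[< S (val t) >]]%SET.
pose rep (y : {set seq_sub ts}) := xget set0 [set S | A S /\ trace S = y].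
apply: (@sub_finite_set _ _ (rep @` setT)); last first.
  exact/finite_image/finite_finset.
move=> S AS; exists (trace S) => //.
have [AS' trS'] : A (rep (trace S)) /\ trace (rep (trace S)) = trace S.
  by apply: (@xgetPex _ set0 [set S' | A S' /\ trace S' = trace S]); exists S.
move: AS' trS'; set S' := rep _ => AS' /setP trS'.
have tr t : t \in ts -> S' t <-> S t.
  move=> t_ts; have := trS' (SeqSub t_ts); rewrite !inE /= => e.
  by split=> /asboolP; [rewrite e | rewrite -e] => /asboolP.
by apply/seteqP; split; apply: A_sub => // t /tr ->.
Qed.

Theorem theorem1p1 (R : realType) (m : nat) (m_ge2 : (2 <= m)%N)
    (m_even : ~~ odd m)
    (K : fieldExtType rat) (iota : {rmorphism K -> algC})
    (K_real : totally_real R K)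
    (V : vectType K) (Lambda : set V) (Q : V -> K)
    (Lambda_lattice : mic_lattice m Lambda Q)
    (Q_posdef : totally_positive_definite R m Q)
    (alpha : K) (alpha_int : integers alpha)
    (alpha_pos : totally_positive R alpha)
    (d : nat) (d_gt0 : (0 < d)%N) :
  finite_set [set S : set algC |
    exists (L : fieldExtType rat) (s : {rmorphism K -> L})
           (j : {rmorphism L -> algC}),
      [/\ S = range j, (forall x : K, j (s x) = iota x), totally_real R L,
          \dim {: L} = d
        & forall beta : L, integers beta -> totally_positive R beta ->
            represents (scalar_extension s Lambda) (base_change_form s m Q)
                       (s alpha * beta)]].
Proof.
have [_ Lambda_fg _] := Lambda_lattice.
have [X XP] :=
  generated_by_small_integers m_ge2 K_real Lambda_fg Q_posdef alpha_pos.
have [T TP] := northcott R d X.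
apply: (@finite_set_of_traces _ T).
move=> _ _ [L [s [j [-> js Lreal dimL repr]]]]
  [L' [s' [j' [-> js' _ _ _]]]] sub.
(* The preimage under j of the second field plays the role of F. *)
suff F_all x : range j' (j x) by move=> _ [x _ <-].
apply: (XP L s (fun x => range j' (j x)) repr) x => [x y||k|x x_int x_le].
- by move=> [x' _ Dx] [y' _ Dy]; exists (x' + y'); rewrite ?rmorphD ?Dx ?Dy.
- by move=> x y [x' _ Dx] [y' _ Dy]; exists (x' * y'); rewrite ?rmorphM ?Dx ?Dy.
- by exists (s' k); rewrite // js' js.
- by apply: sub; [apply: TP Lreal dimL x_int x_le | exists x].
Qed.
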